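(* Let $\gamma>-1$. The pullback $Q^*f=f\circ Q$ defines an isometric isomorphism $$L^2(V,\nu_\gamma)\cong L^2_{\mathrm{even}}(\mathbb{B}^2,\mu_\gamma),\qquad L^2_{\mathrm{even}}(\mathbb{B}^2,\mu_\gamma)=\{F\in L^2(\mathbb{B}^2,\mu_\gamma):F(-z)=F(z)\ \text{a.e.}\}.$$ It also defines an isometric isomorphism $C(V)\cong C_{\mathrm{even}}(\mathbb{B}^2)$ with respect to the uniform norm.
   Context: $V=\{(x,y,t)\in\mathbb{R}^3:x^2+y^2=t^2,\ 0\le t\le1\}$, parametrized by $(x,y,t)=(t\cos\phi,t\sin\phi,t)$, with the probability measure $d\nu_\gamma(t,\phi)=\frac{\gamma+1}{2\pi}(1-t)^\gamma\,dt\,d\phi$ on $0\le t\le1$, $0\le\phi<2\pi$. $\mathbb{B}^2=\{(u,v)\in\mathbb{R}^2:u^2+v^2\le1\}$ carries the probability measure $d\mu_\gamma(u,v)=\frac{\gamma+1}{\pi}(1-u^2-v^2)^\gamma\,du\,dv$. The map $Q:\mathbb{B}^2\to V$ is $Q(u,v)=(u^2-v^2,\,2uv,\,u^2+v^2)$. $C_{\mathrm{even}}(\mathbb{B}^2)$ is the space of continuous functions $F$ on $\mathbb{B}^2$ with $F(-z)=F(z)$ for all $z$. *)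

(* Defs.v *)
From HB Require Import structures.
From mathcomp Require Import all_boot all_order all_algebra.
From mathcomp Require Import all_classical all_reals all_analysis.
From mathcomp Require Import measurable_realfun ring.

Set Implicit Arguments.
Unset Strict Implicit.
Unset Printing Implicit Defensive.

Import Order.TTheory GRing.Theory Num.Theory.
Import numFieldNormedType.Exports.

Local Open Scope classical_set_scope.
Local Open Scope ring_scope.

Section cone_and_disc.
Variable R : realType.

Definition cone_set : set (R * R * R) :=
  [set p | p.1.1 ^+ 2 + p.1.2 ^+ 2 = p.2 ^+ 2 /\ 0 <= p.2 <= 1].

Definition disc_set : set (R * R) := [set z | z.1 ^+ 2 + z.2 ^+ 2 <= 1].

Definition cone : Type := set_type cone_set.
Definition disc : Type := set_type disc_set.

HB.instance Definition _ := Topological.copy cone (set_type cone_set).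
HB.instance Definition _ := Topological.copy disc (set_type disc_set).

Definition cone_val (p : cone) : R * R * R := \val p.
Definition disc_val (z : disc) : R * R := \val z.

Let cone_apex : cone_set (0, 0, 0).
Proof. by split=> /=; rewrite ?expr0n/= ?addr0// lexx ler01. Qed.

Let disc_center : disc_set (0, 0).
Proof. by rewrite /disc_set/= expr0n/= addr0 ler01. Qed.

HB.instance Definition _ := isPointed.Build cone (SigSub (mem_set cone_apex)).
HB.instance Definition _ := isPointed.Build disc (SigSub (mem_set disc_center)).

(* The trace sigma-algebras; they are the Borel sigma-algebras of the subspace
   topologies above. *)
HB.instance Definition _ :=
  Measurable.copy cone (g_sigma_algebra_preimageType cone_val).
HB.instance Definition _ :=
  Measurable.copy disc (g_sigma_algebra_preimageType disc_val).

Lemma quad_subproof (z : disc) :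
  cone_set ((disc_val z).1 ^+ 2 - (disc_val z).2 ^+ 2,
            2 * (disc_val z).1 * (disc_val z).2,
            (disc_val z).1 ^+ 2 + (disc_val z).2 ^+ 2).
Proof.
split=> /=; first by ring.
by rewrite addr_ge0 ?sqr_ge0//=; exact: set_valP z.
Qed.

Definition quad (z : disc) : cone := SigSub (mem_set (quad_subproof z)).

Lemma disc_opp_subproof (z : disc) :
  disc_set (- (disc_val z).1, - (disc_val z).2).
Proof. by rewrite /disc_set/= !sqrrN; exact: set_valP z. Qed.

Definition disc_opp (z : disc) : disc :=
  SigSub (mem_set (disc_opp_subproof z)).

Definition pullback (f : cone -> R) : disc -> R := f \o quad.

End cone_and_disc.

Section measures.
Variable R : realType.
Local Open Scope ereal_scope.

Definition lebesgue2 : 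
    {measure set (measurableTypeR R * measurableTypeR R)%type -> \bar R} :=
  (@lebesgue_measure R \x @lebesgue_measure R).

Definition cone_param (p : R * R) : R * R * R :=
  (p.1 * cos p.2, p.1 * sin p.2, p.1)%R.

Definition cone_param_dom : set (R * R) :=
  [set p | (0 <= p.1 <= 1)%R /\ (0 <= p.2 < 2 * pi)%R].

Definition cone_density (gamma : R) (p : R * R) : R :=
  ((gamma + 1) / (2 * pi) * (1 - p.1) `^ gamma)%R.

Definition disc_density (gamma : R) (z : R * R) : R :=
  ((gamma + 1) / pi * (1 - z.1 ^+ 2 - z.2 ^+ 2) `^ gamma)%R.

(* The hypothesis on gamma is carried by the measures because it is what makes
   the densities nonnegative, hence what makes them measures.
   [cone_measure] is the image under [cone_param] of the measure with density
   [cone_density] on [0, 1] x [0, 2 pi[. *)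
Definition cone_measure (gamma : R) (gamma_gtN1 : (-1 < gamma)%R)
    (A : set (cone R)) : \bar R :=
  \int[lebesgue2]_(p in cone_param_dom `&`
                        cone_param @^-1` (@cone_val R @` A))
    (cone_density gamma p)%:E.

Definition disc_measure (gamma : R) (gamma_gtN1 : (-1 < gamma)%R)
    (A : set (disc R)) : \bar R :=
  \int[lebesgue2]_(z in @disc_val R @` A) (disc_density gamma z)%:E.

Lemma measurable_cone_set : measurable (@cone_set R).
Proof.
have m11 : measurable_fun setT (fun p : R * R * R => p.1.1).
  exact: (measurableT_comp measurable_fst measurable_fst).
have m12 : measurable_fun setT (fun p : R * R * R => p.1.2).
  exact: (measurableT_comp measurable_snd measurable_fst).
have m2 : measurable_fun setT (fun p : R * R * R => p.2) by exact: measurable_snd.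
pose f (p : R * R * R) := (p.1.1 ^+ 2 + p.1.2 ^+ 2 - p.2 ^+ 2)%R.
have mf : measurable_fun setT f.
  by apply: measurable_funB; [apply: measurable_funD|];
    exact: measurable_funX.
rewrite (_ : @cone_set R =
  (f @^-1` [set 0%R]) `&` (snd @^-1` `[0%R, 1%R])); last first.
  apply/seteqP; split=> p; rewrite /cone_set /f/= in_itv/=.
    by move=> [-> ?]; rewrite subrr.
  by move=> [/eqP]; rewrite subr_eq0 => /eqP.
apply: measurableI; rewrite -[X in measurable X]setTI.
- exact: mf.
- exact: m2.
Qed.

Lemma measurable_disc_set : measurable (@disc_set R).
Proof.
have m : measurable_fun setT (fun z : R * R => z.1 ^+ 2 + z.2 ^+ 2)%R.
  by apply: measurable_funD; apply: measurable_funX;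
    [exact: measurable_fst|exact: measurable_snd].
rewrite (_ : @disc_set R =
  (fun z : R * R => z.1 ^+ 2 + z.2 ^+ 2)%R @^-1` `]-oo, 1%R]).
  by rewrite -[X in measurable X]setTI; exact: m.
by apply/seteqP; split=> z; rewrite /disc_set/= in_itv.
Qed.

Lemma measurable_cone_val_image (A : set (cone R)) :
  measurable A -> measurable (@cone_val R @` A).
Proof.
move=> [B mB <-].
rewrite (_ : _ @` _ = B `&` @cone_set R).
  exact: measurableI mB measurable_cone_set.
apply/seteqP; split=> [_ [p [_ Bp] <-]|p [Bp Cp]].
  by split=> //; exact: set_valP p.
by exists (SigSub (mem_set Cp)).
Qed.

Lemma measurable_disc_val_image (A : set (disc R)) :
  measurable A -> measurable (@disc_val R @` A).
Proof.
move=> [B mB <-].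
rewrite (_ : _ @` _ = B `&` @disc_set R).
  exact: measurableI mB measurable_disc_set.
apply/seteqP; split=> [_ [p [_ Bp] <-]|p [Bp Cp]].
  by split=> //; exact: set_valP p.
by exists (SigSub (mem_set Cp)).
Qed.

Lemma measurable_cone_param : measurable_fun setT cone_param.
Proof.
have m1 : measurable_fun setT (fun p : R * R => p.1) by exact: measurable_fst.
have mc : measurable_fun setT (fun p : R * R => cos p.2).
  apply: measurableT_comp; last exact: measurable_snd.
  exact: continuous_measurable_fun (@continuous_cos R).
have ms : measurable_fun setT (fun p : R * R => sin p.2).
  apply: measurableT_comp; last exact: measurable_snd.
  exact: continuous_measurable_fun (@continuous_sin R).
by apply: measurable_fun_pair => //; apply: measurable_fun_pair;
  exact: measurable_funM.
Qed.

Lemma measurable_cone_param_dom : measurable cone_param_dom.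
Proof.
rewrite (_ : cone_param_dom = `[0%R, 1%R] `*` `[0%R, (2 * pi)%R[).
  by apply: measurableX; exact: measurable_itv.
by apply/seteqP; split=> p; rewrite /cone_param_dom/= !in_itv.
Qed.

Lemma measurable_cone_density gamma :
  measurable_fun setT (cone_density gamma).
Proof.
apply: measurable_funM; first exact: measurable_cst.
apply: (measurableT_comp (measurable_powR _)).
by apply: measurable_funB; [exact: measurable_cst|exact: measurable_fst].
Qed.

Lemma measurable_disc_density gamma :
  measurable_fun setT (disc_density gamma).
Proof.
apply: measurable_funM; first exact: measurable_cst.
apply: (measurableT_comp (measurable_powR _)).
apply: measurable_funB; first apply: measurable_funB => //; apply: measurable_funX.
- exact: measurable_fst.
- exact: measurable_snd.
Qed.

Section gamma.
Variables (gamma : R) (gamma_gtN1 : (-1 < gamma)%R).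

Let gamma1_ge0 : (0 <= gamma + 1)%R.
Proof. by rewrite -lerBlDr sub0r ltW. Qed.

Lemma cone_density_ge0 p : (0 <= cone_density gamma p)%R.
Proof. by rewrite !mulr_ge0 ?powR_ge0 ?invr_ge0 ?mulr_ge0 ?pi_ge0. Qed.

Lemma disc_density_ge0 z : (0 <= disc_density gamma z)%R.
Proof. by rewrite !mulr_ge0 ?powR_ge0 ?invr_ge0 ?pi_ge0. Qed.

Let cone_measure0 : cone_measure gamma_gtN1 set0 = 0.
Proof. by rewrite /cone_measure image_set0 preimage_set0 setI0 integral_set0. Qed.

Let cone_measure_ge0 A : 0 <= cone_measure gamma_gtN1 A.
Proof. by apply: integral_ge0 => p _; rewrite lee_fin cone_density_ge0. Qed.

Let cone_val_inj : injective (@cone_val R).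
Proof. exact: val_inj. Qed.

Let disc_val_inj : injective (@disc_val R).
Proof. exact: val_inj. Qed.

Let cone_measure_sigma_additive :
  semi_sigma_additive (cone_measure gamma_gtN1).
Proof.
move=> /= F mF tF mUF.
pose G n := cone_param_dom `&` cone_param @^-1` (@cone_val R @` F n).
have -> : cone_measure gamma_gtN1 (\bigcup_n F n) =
    \int[lebesgue2]_(p in \bigcup_n G n) (cone_density gamma p)%:E.
  by rewrite /cone_measure image_bigcup preimage_bigcup setI_bigcupr.
apply: (@semi_sigma_additive_nng_induced _ _ _ lebesgue2
  (fun p => (cone_density gamma p)%:E)) => /=.
- by apply/measurable_EFinP; exact: measurable_cone_density.
- by move=> p; rewrite lee_fin cone_density_ge0.
- move=> n; apply: measurableI; first exact: measurable_cone_param_dom.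
  rewrite -[X in measurable X]setTI.
  by apply: measurable_cone_param => //; exact: measurable_cone_val_image.
- move=> i j _ _ [p [[_ [x Fx xp]] [_ [y Fy yp]]]].
  apply: tF => //; exists x; split => //.
  by rewrite (_ : x = y)//; apply: cone_val_inj; rewrite xp yp.
- apply: bigcup_measurable => n _.
  apply: measurableI; first exact: measurable_cone_param_dom.
  rewrite -[X in measurable X]setTI.
  by apply: measurable_cone_param => //; exact: measurable_cone_val_image.
Qed.

HB.instance Definition _ := isMeasure.Build _ _ _ (cone_measure gamma_gtN1)
  cone_measure0 cone_measure_ge0 cone_measure_sigma_additive.

Let disc_measure0 : disc_measure gamma_gtN1 set0 = 0.
Proof. by rewrite /disc_measure image_set0 integral_set0. Qed.

Let disc_measure_ge0 A : 0 <= disc_measure gamma_gtN1 A.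
Proof. by apply: integral_ge0 => z _; rewrite lee_fin disc_density_ge0. Qed.

Let disc_measure_sigma_additive :
  semi_sigma_additive (disc_measure gamma_gtN1).
Proof.
move=> /= F mF tF mUF.
pose G n := @disc_val R @` F n.
have -> : disc_measure gamma_gtN1 (\bigcup_n F n) =
    \int[lebesgue2]_(z in \bigcup_n G n) (disc_density gamma z)%:E.
  by rewrite /disc_measure image_bigcup.
apply: (@semi_sigma_additive_nng_induced _ _ _ lebesgue2
  (fun z => (disc_density gamma z)%:E)) => /=.
- by apply/measurable_EFinP; exact: measurable_disc_density.
- by move=> z; rewrite lee_fin disc_density_ge0.
- by move=> n; exact: measurable_disc_val_image.
- move=> i j _ _ [p [[x Fx xp] [y Fy yp]]].
  apply: tF => //; exists x; split => //.
  by rewrite (_ : x = y)//; apply: disc_val_inj; rewrite xp yp.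
- by apply: bigcup_measurable => n _; exact: measurable_disc_val_image.
Qed.

HB.instance Definition _ := isMeasure.Build _ _ _ (disc_measure gamma_gtN1)
  disc_measure0 disc_measure_ge0 disc_measure_sigma_additive.

End gamma.
End measures.

Section L2.
Context d (T : measurableType d) (R : realType)
  (mu : {measure set T -> \bar R}).

Definition L2norm (f : LspaceType2 mu) : \bar R := 'N[mu]_2%:E[EFin \o f]%E.

(* [LspaceType2] carries no algebraic structure: this says that the class [h]
   is the linear combination [a *: f + g] of the classes [f] and [g]. *)
Definition L2lincomb (a : R) (f g h : LspaceType2 mu) : Prop :=
  (h : T -> R) = (fun x => a * f x + g x) %[ae mu].

End L2.

Definition L2_linear (R : realType) d1 (T1 : measurableType d1)
    d2 (T2 : measurableType d2) (mu1 : {measure set T1 -> \bar R})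
    (mu2 : {measure set T2 -> \bar R})
    (Phi : LspaceType2 mu1 -> LspaceType2 mu2) : Prop :=
  forall (a : R) f g h, L2lincomb a f g h ->
    L2lincomb a (Phi f) (Phi g) (Phi h).

Definition L2_isometry (R : realType) d1 (T1 : measurableType d1)
    d2 (T2 : measurableType d2) (mu1 : {measure set T1 -> \bar R})
    (mu2 : {measure set T2 -> \bar R})
    (Phi : LspaceType2 mu1 -> LspaceType2 mu2) : Prop :=
  forall f, L2norm (Phi f) = L2norm f.

Section even.
Variable R : realType.

Definition L2_even (gamma : R) (gamma_gtN1 : -1 < gamma) :
    set (LspaceType2 (disc_measure gamma_gtN1)) :=
  [set F | {ae disc_measure gamma_gtN1, forall z, F (disc_opp z) = F z}].

(* [Phi] is the map induced by [pullback] on almost everywhere classes: on any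
   measurable representative [g] of a class, it is given by [g \o quad]. *)
Definition L2_induced_by_pullback (gamma : R) (gamma_gtN1 : -1 < gamma)
    (Phi : LspaceType2 (cone_measure gamma_gtN1) ->
           LspaceType2 (disc_measure gamma_gtN1)) : Prop :=
  forall (f : LspaceType2 (cone_measure gamma_gtN1)) (g : cone R -> R),
    measurable_fun [set: cone R] g ->
    (f : cone R -> R) = g %[ae cone_measure gamma_gtN1] ->
    (Phi f : disc R -> R) = pullback g %[ae disc_measure gamma_gtN1].

Definition C_cone : set (cone R -> R) := [set f | continuous f].

Definition C_even : set (disc R -> R) :=
  [set F | continuous F /\ forall z, F (disc_opp z) = F z].

Definition uniform_norm (T : Type) (f : T -> R) : R :=
  sup (range (fun x => `|f x|)).

End even.

Arguments L2_even {R gamma} gamma_gtN1.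
Arguments C_cone : clear implicits.
Arguments C_even : clear implicits.

(* Main.v *)
(* Writing z = u + i v, the map [quad] is z |-> (z^2, |z|^2), so its fibres are
   the pairs {z, - z}: functions on the cone are the even functions on the disc,
   and [quad_section] picks one of the two square roots.  Continuity descends
   because [quad] maps closed sets to closed sets, the disc being compact.

   For L2 everything reduces to the fact that [cone_measure] is the image of
   [disc_measure] under [quad].  By evenness it suffices to integrate over the
   half-plane v > 0.  There, u = - v m followed by t = (1 + m^2) v^2 and
   phi = pi + 2 atan m turns du dv into dt dphi / 4, using Tonelli's theorem and
   three one-variable substitutions.  A substitution for measurable nonnegative
   integrands follows from the uniqueness of a measure with prescribed finite
   values on the intervals ]x, y]. *)
From HB Require Import structures.
Require Import Defs.
From mathcomp Require Import all_boot all_order all_algebra.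
From mathcomp Require Import all_classical all_reals all_analysis.
From mathcomp Require Import measurable_realfun ring lra.
Set Implicit Arguments.
Unset Strict Implicit.
Unset Printing Implicit Defensive.

Import Order.TTheory GRing.Theory Num.Theory.
Import numFieldNormedType.Exports.
Local Open Scope classical_set_scope.
Local Open Scope ring_scope.

(** * The squaring map and continuous functions *)

Section section_of_quad.
Context {R : realType}.
Implicit Types (p : R * R * R) (z : R * R).

Definition planar_quad z : R * R * R :=
  (z.1 ^+ 2 - z.2 ^+ 2, 2 * z.1 * z.2, z.1 ^+ 2 + z.2 ^+ 2).

Lemma cone_val_quad (z : disc R) : cone_val (quad z) = planar_quad (disc_val z).
Proof. by []. Qed.

Lemma cone_val_inj : injective (@cone_val R).
Proof. exact: val_inj. Qed.

Lemma disc_val_inj : injective (@disc_val R).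
Proof. exact: val_inj. Qed.

(** The half-angle formulas: for [p = (x, y, t)] on the cone this is a square root of [x + i y], a
    number of modulus [t]. The branch has nonnegative first coordinate; the sign of [y], counted as
    +1 at 0, goes to the second one. *)
Definition half_angle p : R * R :=
  (Num.sqrt ((p.2 + p.1.1) / 2),
   (if p.1.2 < 0 then -1 else 1) * Num.sqrt ((p.2 - p.1.1) / 2)).

Lemma half_angleK p : cone_set p -> planar_quad (half_angle p) = p.
Proof.
case: p => [[x y] t] [/= xyt /andP[t0 _]].
(* This bound makes both radicands nonnegative. *)
have xt : `|x| <= t.
  by rewrite -(ger0_norm t0) -ler_sqr ?nnegrE// !real_normK ?num_real//
    -xyt lerDl sqr_ge0.
move: xt; rewrite ler_norml => /andP[xt1 xt2].
have a0 : 0 <= (t + x) / 2 by rewrite divr_ge0// -lerBlDl sub0r.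
have b0 : 0 <= (t - x) / 2 by rewrite divr_ge0// subr_ge0.
set s : R := if y < 0 then -1 else 1.
have s2 : s ^+ 2 = 1 :> R by rewrite /s; case: ifP; rewrite ?sqrrN expr1n.
have sy : s * `|y| = y.
  by rewrite /s; case: ltP => y0; [rewrite ltr0_norm// mulN1r opprK|
    rewrite ger0_norm// mul1r].
rewrite /planar_quad /half_angle/= -/s exprMn s2 mul1r !sqr_sqrtr//.
congr (_, _, _); [by field| |by field].
(* The product of the two roots is the root of [(t ^+ 2 - x ^+ 2) / 4], that is half the absolute
   value of [y], and [s] restores the sign. *)
transitivity (s * (2 * (Num.sqrt ((t + x) / 2) * Num.sqrt ((t - x) / 2)))).
  by ring.
rewrite -sqrtrM// -[RHS]sy; congr (_ * _).
rewrite (_ : (t + x) / 2 * _ = (`|y| / 2) ^+ 2); last first.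
  have y2 : y ^+ 2 = t ^+ 2 - x ^+ 2 by rewrite -xyt addrC addKr.
  rewrite expr_div_n real_normK ?num_real// y2.
  by field.
by rewrite sqrtr_sqr ger0_norm ?divr_ge0// mulrC divfK// pnatr_eq0.
Qed.

Lemma half_angle_subproof (p : cone R) : disc_set (half_angle (cone_val p)).
Proof.
have := half_angleK (set_valP p); rewrite -/(cone_val p).
move=> /(congr1 snd)/=; rewrite /disc_set/= => ->.
by have [_ /andP[]] := set_valP p.
Qed.

Definition quad_section (p : cone R) : disc R :=
  SigSub (mem_set (half_angle_subproof p)).

Lemma quad_sectionK : cancel quad_section (@quad R).
Proof. by move=> p; apply: cone_val_inj; exact: half_angleK (set_valP p). Qed.

(** The first and third coordinates determine [u ^+ 2] and [v ^+ 2], hence [u] and [v] up to sign;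
    the second one, [2 * u * v], links the two signs. *)
Lemma planar_quad_inj z w :
  planar_quad z = planar_quad w -> z = w \/ z = (- w.1, - w.2).
Proof.
case: z w => [u v] [u' v'] [/= e1 e2 e3].
have uu : u ^+ 2 = u' ^+ 2 by lra.
have vv : v ^+ 2 = v' ^+ 2 by lra.
have uv : u * v = u' * v' by lra.
move/eqP: uu; rewrite eqf_sqr => /orP[]/eqP uE; subst u;
  move/eqP: vv; rewrite eqf_sqr => /orP[]/eqP vE; subst v;
  [by left| | |by right].
(* When only one of the two signs changes, the products force [u' * v' = 0], so a coordinate
   vanishes and its sign is immaterial. *)
- have /eqP : u' * v' = 0 by lra.
  by rewrite mulf_eq0 => /orP[]/eqP->; rewrite ?oppr0; [right|left].
- have /eqP : u' * v' = 0 by lra.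
  by rewrite mulf_eq0 => /orP[]/eqP->; rewrite ?oppr0; [left|right].
Qed.

Lemma quad_inj (z w : disc R) : quad z = quad w -> z = w \/ z = disc_opp w.
Proof.
move=> /(congr1 (@cone_val R)) /planar_quad_inj[] e; [left|right];
  exact: disc_val_inj.
Qed.

Lemma quad_opp (z : disc R) : quad (disc_opp z) = quad z.
Proof.
apply: cone_val_inj; rewrite !cone_val_quad /planar_quad/= !sqrrN.
by congr (_, _, _); ring.
Qed.

Lemma quad_sectionP (z : disc R) :
  quad_section (quad z) = z \/ quad_section (quad z) = disc_opp z.
Proof. by apply: quad_inj; rewrite quad_sectionK. Qed.

Lemma disc_oppK : involutive (@disc_opp R).
Proof.
move=> z; apply: disc_val_inj.
transitivity (- - (disc_val z).1, - - (disc_val z).2); first by [].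
by rewrite !opprK; case: (disc_val z).
Qed.

(** [quad] is onto, with right inverse [quad_section], so both suprema are taken over the same
    set. *)
Lemma uniform_norm_pullback (f : cone R -> R) :
  uniform_norm (pullback f) = uniform_norm f.
Proof.
rewrite /uniform_norm; congr sup; apply/seteqP.
split=> [_ [z _ <-]|_ [p _ <-]]; first by exists (quad z).
by exists (quad_section p) => //; rewrite /pullback/= quad_sectionK.
Qed.

Lemma pullback_inj : injective (@pullback R).
Proof.
move=> f g fg; apply/funext => p; rewrite -(quad_sectionK p).
exact: (congr1 (fun h => h (quad_section p)) fg).
Qed.

Lemma pullback_quad_section (F : disc R -> R) :
  (forall z : disc R, F (disc_opp z) = F z) -> pullback (F \o quad_section) = F.
Proof.
move=> evenF; apply/funext => z; rewrite /pullback/=.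
by case: (quad_sectionP z) => ->.
Qed.

End section_of_quad.

(** * Continuity of [quad] and descent of continuity to the cone *)

Section continuity.
Context {R : realType}.

Lemma continuous_fst2 : continuous (fun z : R * R => z.1).
Proof. by move=> z; exact: cvg_fst. Qed.

Lemma continuous_snd2 : continuous (fun z : R * R => z.2).
Proof. by move=> z; exact: cvg_snd. Qed.

Lemma continuous_planar_quad : continuous (@planar_quad R).
Proof.
move=> z; have c1 := @continuous_fst2 z; have c2 := @continuous_snd2 z.
have h1 : {for z, continuous (fun w : R * R => w.1 ^+ 2 - w.2 ^+ 2)}.
  by apply: cvgB; [exact: (cvgM c1 c1)|exact: (cvgM c2 c2)].
have h2 : {for z, continuous (fun w : R * R => 2 * w.1 * w.2)}.
  by apply: cvgM => //; apply: cvgM => //; exact: cvg_cst.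
have h3 : {for z, continuous (fun w : R * R => w.1 ^+ 2 + w.2 ^+ 2)}.
  by apply: cvgD; [exact: (cvgM c1 c1)|exact: (cvgM c2 c2)].
exact: cvg_pair (cvg_pair h1 h2) h3.
Qed.

Lemma continuous_disc_val : continuous (@disc_val R).
Proof. exact: initial_continuous. Qed.

Lemma continuous_cone_val : continuous (@cone_val R).
Proof. exact: initial_continuous. Qed.

Lemma continuous_quad : continuous (@quad R).
Proof.
apply: continuous_comp_initial => z.
apply: (@continuous_comp _ _ _ (@disc_val R) (@planar_quad R)).
  exact: continuous_disc_val.
exact: continuous_planar_quad.
Qed.

Lemma compact_disc_set : compact (@disc_set R).
Proof.
apply: (@subclosed_compact _ _
  (`[-1, 1]%classic `*` `[-1, 1]%classic : set (R * R))).
- rewrite (_ : @disc_set R =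
    (fun z : R * R => z.1 ^+ 2 + z.2 ^+ 2) @^-1` [set x | x <= 1])//.
  apply: closed_comp; last exact: closed_le.
  move=> z _; have c1 := @continuous_fst2 z; have c2 := @continuous_snd2 z.
  by apply: cvgD; [exact: (cvgM c1 c1)|exact: (cvgM c2 c2)].
- by apply: compact_setX; exact: segment_compact.
- move=> z z1; have le1 (x y : R) : x ^+ 2 + y ^+ 2 <= 1 -> -1 <= x <= 1.
    move=> xy1; rewrite -ler_norml -ler_sqr ?nnegrE// expr1n.
    by rewrite real_normK ?num_real// (le_trans _ xy1)// lerDl sqr_ge0.
  split; rewrite /= in_itv/=; first exact: (le1 _ z.2).
  by apply: (le1 _ z.1); rewrite addrC.
Qed.

(* [quad] is a quotient map because the disc is compact. *)
Lemma continuous_quad_section (F : disc R -> R) : continuous F ->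
  (forall z, F (disc_opp z) = F z) -> continuous (F \o quad_section).
Proof.
move=> cF evenF; apply/continuous_closedP => D cD.
have /continuous_closedP /(_ D cD) cFD := cF.
(* The complement of [W] is a closed planar set whose trace on the disc is the preimage of [D] under
   [F]. *)
have [W oW WE] : exists2 W, open W & disc_val (R := R) @^-1` W = ~` (F @^-1` D).
  by have [W ? ?] := closed_openC cFD; exists W.
(* A closed part of the compact disc has a compact, hence closed, image; the trace of this image on
   the cone is the required preimage of [D]. *)
have cK : closed (@planar_quad R @` (~` W `&` @disc_set R)).
  apply: compact_closed; first exact: norm_hausdorff.
  apply: continuous_compact.
    by apply: continuous_subspaceT => z; exact: continuous_planar_quad.
  rewrite setIC; apply: compact_closedI; first exact: compact_disc_set.
  exact: open_closedC.
rewrite (_ : _ @^-1` _ =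
    cone_val (R := R) @^-1` (planar_quad @` (~` W `&` @disc_set R))).
  by apply: closed_comp => // p _; exact: continuous_cone_val.
apply/seteqP; split=> p /=.
- move=> Dp; exists (disc_val (quad_section p)).
    split; last exact: set_valP.
    move=> Wp; have : (disc_val (R := R) @^-1` W) (quad_section p) by [].
    by rewrite WE.
  by rewrite -cone_val_quad quad_sectionK.
- move=> [z [nWz dz] zp].
  pose z' : disc R := SigSub (mem_set dz).
  have -> : p = quad z' by exact: cone_val_inj.
  (* The section may return the other square root, on which [F] takes the same value by evenness. *)
  have -> : F (quad_section (quad z')) = F z'.
    by case: (quad_sectionP z') => ->.
  apply: contrapT => nD; apply: nWz.
  have : (~` (F @^-1` D)) z' by [].
  by rewrite -WE.
Qed.

Lemma set_bij_pullback_continuous :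
  set_bij (C_cone R) (C_even R) (@pullback R).
Proof.
split.
- move=> f cf; split=> [z|z]; last by rewrite /pullback/= quad_opp.
  by apply: continuous_comp; [exact: continuous_quad|exact: cf].
- by move=> f g _ _; exact: pullback_inj.
- move=> F [cF evenF]; exists (F \o quad_section).
    exact: continuous_quad_section.
  exact: pullback_quad_section.
Qed.

End continuity.

(** * Substitution for nonnegative measurable integrands *)

Section image_measure.
Local Open Scope ereal_scope.
Context d1 d2 (X : measurableType d1) (Y : measurableType d2) (R : realType).
Variables (mu : {measure set X -> \bar R}) (nu : {measure set Y -> \bar R}).
Variables (phi : X -> Y) (mphi : measurable_fun [set: X] phi).
Hypothesis nuE : forall A, measurable A -> nu A = mu (phi @^-1` A).

(** The two measures are related by a hypothesis on sets, so that this applies to measures not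
    defined as pushforwards: [cone_measure], and Lebesgue measure under reflection. *)
Lemma ge0_integral_image_measure (f : Y -> \bar R) :
  measurable_fun [set: Y] f -> (forall y, 0 <= f y) ->
  \int[nu]_y f y = \int[mu]_x f (phi x).
Proof.
move=> mf f0.
have E := @ge0_integral_pushforward _ _ _ _ R _ mphi mu setT f
  measurableT mf (fun y _ => f0 y).
apply: (etrans _ E).
(* The instance is named because it depends on [mphi], which unification cannot
   recover from [pushforward mu phi]. *)
pose m1 : {measure set Y -> \bar R} :=
  measure_function_pushforward__canonical__measure_function_Measure mu mphi.
by apply: (@eq_measure_integral _ _ R setT m1 nu) => A mA _; exact: nuE.
Qed.

End image_measure.

(** * Measures given by a density *)

Section density_measure.
Local Open Scope ereal_scope.
Context d (T : measurableType d) (R : realType).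
Variable mu : {measure set T -> \bar R}.
Variables (f : T -> R) (mf : measurable_fun [set: T] f).
Hypothesis f0 : forall x, (0 <= f x)%R.

(** The two proofs are arguments so that the term itself determines the measure structure declared
    below. *)
Definition density_measure (mf : measurable_fun [set: T] f)
  (f0 : forall x, (0 <= f x)%R) (A : set T) := \int[mu]_(x in A) (f x)%:E.

Let density_measure0 : density_measure mf f0 set0 = 0.
Proof. exact: integral_set0. Qed.

Let density_measure_ge0 A : 0 <= density_measure mf f0 A.
Proof. by apply: integral_ge0 => x _; rewrite lee_fin. Qed.

Let density_measure_sigma_additive :
  semi_sigma_additive (density_measure mf f0).
Proof.
apply: semi_sigma_additive_nng_induced; first exact/measurable_EFinP.
by move=> x; rewrite lee_fin.
Qed.

HB.instance Definition _ := isMeasure.Build _ _ _ (density_measure mf f0)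
  density_measure0 density_measure_ge0 density_measure_sigma_additive.

Import HBNNSimple.

(** The usual induction: the definition for indicators, linearity for simple functions, monotone
    convergence in general. *)
Lemma ge0_integral_density (g : T -> \bar R) :
  measurable_fun [set: T] g -> (forall x, 0 <= g x) ->
  \int[density_measure mf f0]_x g x = \int[mu]_x (g x * (f x)%:E).
Proof.
move=> mg g0; pose h := nnsfun_approx measurableT mg.
have hg x : (h n x)%:E @[n --> \oo] --> g x.
  by apply: cvg_nnsfun_approx => //.
have h_nd x : {homo (fun n => (h n x)%:E) : n m / (n <= m)%N >-> n <= m}.
  by move=> m n mn; rewrite lee_fin; exact/lefP/nd_nnsfun_approx.
transitivity (limn (fun n => \int[density_measure mf f0]_x (h n x)%:E)).
  rewrite -monotone_convergence//.
  - by apply: eq_integral => x _; apply/esym/cvg_lim => //; exact: hg.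
  - by move=> n; exact/measurable_EFinP/measurable_funP.
  - by move=> n x _; rewrite lee_fin.
transitivity (limn (fun n => \int[mu]_x ((h n x)%:E * (f x)%:E))); last first.
  rewrite -monotone_convergence//.
  - apply: eq_integral => x _; apply/cvg_lim => //.
    by apply: cvgeZr => //; exact: hg.
  - move=> n; apply/measurable_EFinP; apply: measurable_funM => //.
  - by move=> n x _; rewrite mule_ge0 ?lee_fin.
  - by move=> x _ m n mn; apply: lee_wpmul2r; [rewrite lee_fin|exact: h_nd].
congr (limn _); apply/funext => n.
have mE r : measurable (h n @^-1` [set r]) by exact: measurable_sfunP.
rewrite integralT_nnsfun sintegralE.
transitivity (\int[mu]_x \sum_(r \in range (h n))
    (r * \1_(h n @^-1` [set r]) x * f x)%:E); last first.
  apply: eq_integral => x _; rewrite fsumEFin// -EFinM [in RHS]fimfunE.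
  by rewrite mulr_fsuml.
rewrite ge0_integral_fsum//; last 2 first.
- move=> r; apply/measurable_EFinP; apply: measurable_funM => //.
  exact: measurable_funM.
(* Here [r] is an arbitrary real: where the indicator is nonzero, [r] is a value of [h n], hence
   nonnegative. *)
- move=> r x _; rewrite lee_fin mulr_ge0// indicE.
  by case: (boolP (x \in _)) => [/[!inE]/= <-|_]; rewrite ?mulr1 ?mulr0.
apply: eq_fsbigr => r /[!inE] -[t _ <-].
rewrite /density_measure -ge0_integralZl//; last 3 first.
- exact/measurable_EFinP/measurable_funTS.
- by move=> x _; rewrite lee_fin.
- by rewrite lee_fin.
rewrite integral_mkcond.
apply: eq_integral => x _; rewrite patchE indicE.
by case: ifPn => _; rewrite ?mulr1 ?mulr0 ?mul0r ?mule0 ?EFinM.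
Qed.

End density_measure.

Section substitution.
Local Open Scope ereal_scope.
Context {R : realType}.
Local Notation mu := (@lebesgue_measure R).

(* [psi] is the inverse of [phi] on [B]; stating this on intervals allows [phi]
   to be constant outside the preimage of [B]. *)
Lemma ge0_integral_substitution (phi dphi psi : R -> R) (B : set R)
    (g : R -> \bar R) :
  measurable B -> measurable_fun B psi -> measurable_fun [set: R] dphi ->
  (forall x, (0 <= dphi x)%R) ->
  (forall x y, (x < y)%R ->
    \int[mu]_(t in `]x, y]) (dphi t)%:E = (phi y - phi x)%:E) ->
  (forall x y, (x < y)%R ->
    B `&` psi @^-1` `]x, y]%classic = `]phi x, phi y]%classic) ->
  measurable_fun [set: R] g -> (forall x, 0 <= g x) ->
  \int[mu]_(p in B) g (psi p) = \int[mu]_x (g x * (dphi x)%:E).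
Proof.
move=> mB mpsi mdphi dphi0 int_dphi psi_itv mg g0.
(* Extending [psi] by 0 makes it total; the density [\1_B] of [nu] keeps the points outside [B] from
   putting mass at 0. *)
pose psiB : measurableTypeR R -> measurableTypeR R := psi \_ B.
have mpsiB : measurable_fun setT psiB.
  exact: (measurable_restrictT psi mB).1.
have m1B : measurable_fun setT (\1_B : measurableTypeR R -> R).
  exact: measurable_indic.
have ge0_1B (x : measurableTypeR R) : (0 <= (\1_B x : R))%R by [].
pose nu : {measure set (measurableTypeR R) -> \bar R} :=
  density_measure mu m1B ge0_1B.
transitivity (\int[nu]_p (g \o psiB) p).
  rewrite ge0_integral_density;
    [|exact: (measurableT_comp mg mpsiB)|by move=> x; exact: g0].
  rewrite [LHS]integral_mkcond; apply: eq_integral => p _.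
  by rewrite /= /psiB !patchE indicE; case: ifPn => _; rewrite ?mule1 ?mule0.
rewrite -[LHS](@ge0_integral_pushforward _ _ _ _ _ _ mpsiB nu setT g)//.
rewrite -(ge0_integral_density mu mdphi dphi0)//.
pose m1 : {measure set (measurableTypeR R) -> \bar R} :=
  measure_function_pushforward__canonical__measure_function_Measure nu mpsiB.
pose m2 : {measure set (measurableTypeR R) -> \bar R} :=
  density_measure mu mdphi dphi0.
suff m12 A : measurable A -> m1 A = m2 A.
  exact: (@eq_measure_integral _ _ R setT m2 m1 g (fun A mA _ => m12 A mA)).
move=> mA.
(* The intervals []x, y]] are stable under intersection, generate the sigma-algebra and exhaust the
   line through []-k, k]]. *)
apply: (@measure_unique _ _ (measurableTypeR R) (@ocitv R)
  (fun k => `](- k%:R)%R, k%:R]%classic) _ _ _ _ m1 m2) => //.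
- exact: ocitvI.
- move=> k; exact: is_ocitv.
- apply/seteqP; split=> // x _; exists (Num.bound x) => //=.
  by rewrite in_itv/= ltrNl unstable.ltrNbound ltW// unstable.ltr_bound.
- move=> _ [[x y] _ <-]/=.
  have [xy|yx] := ltP x y; last first.
    by rewrite set_itv_ge ?bnd_simp -?leNgt// !measure0.
  rewrite /m1 /m2/= /pushforward /density_measure int_dphi//.
  rewrite integral_indic//; last first.
    by rewrite -[X in measurable X]setTI; exact: (mpsiB).
  have -> : B `&` psiB @^-1` `]x, y]%classic = `]phi x, phi y]%classic.
    rewrite -psi_itv//; apply/seteqP; split=> p [Bp]/=;
    by rewrite /psiB patchE mem_set.
  rewrite /= lebesgue_measure_itv/= lte_fin; case: ltP => // phi_yx.
  (* The image interval is empty here; as the integral of [dphi] is nonnegative, [phi y = phi x]. *)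
  congr EFin; apply/eqP; rewrite eq_le subr_le0 phi_yx andbT -lee_fin.
  by rewrite -int_dphi// integral_ge0// => t _; rewrite lee_fin.
- move=> k; rewrite /m1/= /pushforward /density_measure integral_indic//;
    last first.
    by rewrite -[X in measurable X]setTI; exact: (mpsiB).
  (* For [k = 0] the interval is empty; otherwise its mass is the length of a bounded interval,
     hence finite. *)
  have [k0|k0] := ltP (- k%:R)%R (k%:R : R).
    have -> : B `&` psiB @^-1` `](- k%:R)%R, k%:R]%classic =
        `]phi (- k%:R)%R, phi k%:R]%classic.
      rewrite -psi_itv//; apply/seteqP; split=> p [Bp]/=;
      by rewrite /psiB patchE mem_set.
    by rewrite /= lebesgue_measure_itv/=; case: ifP => _; rewrite ?ltry.
  by rewrite set_itv_ge ?bnd_simp -?leNgt// preimage_set0 setI0 measure0 ltry.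
Qed.

End substitution.

(** * Scaling, squaring and the tangent of the half-angle *)

Section one_variable_substitutions.
Local Open Scope ereal_scope.
Context {R : realType}.
Local Notation mu := (@lebesgue_measure R).

(** Take [f \o phi] for [g] in the previous substitution: [psi] cancels on [B]. *)
Lemma ge0_integral_comp (phi dphi psi : R -> R) (B : set R)
    (f : R -> \bar R) :
  measurable B -> measurable_fun B psi -> measurable_fun [set: R] phi ->
  measurable_fun [set: R] dphi -> (forall x, (0 <= dphi x)%R) ->
  (forall p, B p -> phi (psi p) = p) ->
  (forall x y, (x < y)%R ->
    \int[mu]_(t in `]x, y]) (dphi t)%:E = (phi y - phi x)%:E) ->
  (forall x y, (x < y)%R ->
    B `&` psi @^-1` `]x, y]%classic = `]phi x, phi y]%classic) ->
  measurable_fun [set: R] f -> (forall x, 0 <= f x) ->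
  \int[mu]_(p in B) f p = \int[mu]_x (f (phi x) * (dphi x)%:E).
Proof.
move=> mB mpsi mphi mdphi dphi0 psiK int_dphi psi_itv mf f0.
rewrite -(ge0_integral_substitution mB mpsi mdphi dphi0 int_dphi psi_itv)//.
- by apply: eq_integral => p /[!inE] Bp; rewrite psiK.
- exact: (measurableT_comp mf mphi).
Qed.

(** The fundamental theorem of calculus on half-open intervals, in the form in which the
    substitutions require [dphi] to be the derivative of [phi]. *)
Lemma integral_itv_derive (F f : R -> R) (x y : R) : (x < y)%R ->
  continuous f -> (forall z : R, is_derive z 1%R F (f z)) ->
  \int[mu]_(t in `]x, y]) (f t)%:E = (F y - F x)%:E.
Proof.
move=> xy cf dF.
have F' (z : R) : derivable F z 1%R by case: (dF z).
have cF : continuous F.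
  by move=> z; apply: differentiable_continuous; apply/derivable1_diffP.
rewrite integral_itv_obnd_cbnd; last first.
  apply/measurable_EFinP; apply: measurable_funTS.
  exact: continuous_measurable_fun.
rewrite (@continuous_FTC2 _ f F)//.
- exact: continuous_subspaceT.
- split.
  + by move=> z _; exact: F'.
  + exact/cvg_at_right_filter/cF.
  + exact/cvg_at_left_filter/cF.
- by move=> z _; rewrite derive1E; exact: derive_val.
Qed.

Lemma ge0_integral_scale (v : R) (f : R -> \bar R) : (0 < v)%R ->
  measurable_fun [set: R] f -> (forall x, 0 <= f x) ->
  \int[mu]_u f u = \int[mu]_m (f (v * m)%R * v%:E).
Proof.
move=> v0 mf f0.
apply: (@ge0_integral_comp (fun m => v * m)%R (cst v) (fun u => u / v)%R
  setT) => //.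
- exact: measurable_funM.
- exact: measurable_funM.
- by move=> _ /=; exact: ltW.
- by move=> u _; rewrite mulrC divfK// gt_eqF.
- move=> x y xy; apply: (@integral_itv_derive (fun m => v * m)%R (cst v)) => //.
  + exact: cst_continuous.
  + move=> z; have := @is_deriveZ R R R id v z 1%R 1%R (is_derive_id _ _).
    by rewrite /GRing.scale/= mulr1.
- move=> x y xy; rewrite setTI; apply/seteqP; split=> u /=;
  by rewrite !in_itv/= ltr_pdivlMr// ler_pdivrMr// ![(_ * v)%R]mulrC.
Qed.

(** The substitution [t = s * v ^+ 2]. Truncating [v] at 0 lets the right-hand integral run over the
    whole line, the Jacobian being 0 for [v <= 0]. *)
Lemma ge0_integral_square (s : R) (f : R -> \bar R) : (0 < s)%R ->
  measurable_fun [set: R] f -> (forall x, 0 <= f x) ->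
  \int[mu]_(t in `]0%R, +oo[) f t =
  \int[mu]_v (f (s * Num.max v 0 ^+ 2)%R * (2 * s * Num.max v 0)%:E).
Proof.
move=> s0 mf f0.
have mmax : measurable_fun [set: R] (fun v : R => Num.max v 0)%R.
  exact: measurable_maxr.
apply: (@ge0_integral_comp (fun v => s * Num.max v 0 ^+ 2)%R
  (fun v => 2 * s * Num.max v 0)%R (fun t => Num.sqrt (t / s))%R) => //.
- apply: measurable_funTS.
  apply: (measurableT_comp (continuous_measurable_fun (@sqrt_continuous R))).
  exact: measurable_funM.
- by apply: measurable_funM => //; exact: measurable_funX.
- exact: measurable_funM.
- by move=> x; rewrite !mulr_ge0 ?(ltW s0)// le_max lexx orbT.
- move=> t /=; rewrite in_itv/= andbT => t0.
  rewrite max_l ?sqrtr_ge0// sqr_sqrtr ?divr_ge0 ?ltW//.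
  by rewrite mulrC divfK// gt_eqF.
- move=> x y xy.
  (* Only the part of the interval above 0 counts, and there [s * t ^+ 2] is an antiderivative. *)
  transitivity (\int[mu]_(t in `]Num.max x 0%R, y]) (2 * s * t)%:E).
    rewrite (_ : `]Num.max x 0%R, y]%classic =
      `]x, y]%classic `&` `]0%R, +oo[%classic); last first.
      apply/seteqP; split=> t /=; rewrite !in_itv/= gt_max andbT.
        by move=> /andP[/andP[-> ->] ->].
      by move=> [/andP[-> ->] ->].
    rewrite [RHS]integral_mkcondr; apply: eq_integral => t _.
    rewrite patchE; case: ifPn; rewrite (inE, notin_setE)/= in_itv/= andbT.
      by move=> t0; rewrite max_l// ltW.
    by move=> /negP; rewrite -leNgt => t0; rewrite max_r// mulr0.
  have [xy0|yx0] := ltP (Num.max x 0)%R y.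
    have y0 : (0 < y)%R by move: xy0; rewrite gt_max => /andP[].
    rewrite (@max_l _ _ y 0%R) ?ltW//.
    apply: (@integral_itv_derive (fun t => s * t ^+ 2)%R) => //.
    + move=> t; apply: cvgM; [exact: cvg_cst|exact: cvg_id].
    + move=> z; have := is_deriveZ s (is_deriveX 2 (is_derive_id z (1%R : R))).
      by move=> dF; apply: (is_derive_eq dF); rewrite /GRing.scale/=; ring.
  (* Since [x < y], this case means [y <= 0]: the interval is empty and both truncations are 0. *)
  rewrite set_itv_ge ?bnd_simp -?leNgt// integral_set0.
  have y0 : (y <= 0)%R by move: yx0; rewrite le_max leNgt xy.
  rewrite !max_r ?subrr//; exact: (le_trans (ltW xy)).
- move=> x y xy; apply/seteqP; split=> t /=; rewrite !in_itv/= andbT.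
  + move=> [t0 /andP[xt ty]].
    have y0 : (0 <= y)%R by rewrite (le_trans _ ty)// sqrtr_ge0.
    have ts : (0 <= t / s)%R by rewrite divr_ge0// ltW.
    rewrite (@max_l _ _ y 0%R)//; apply/andP; split; last first.
      rewrite mulrC -ler_pdivrMr// -(@sqr_sqrtr _ (t / s)%R)//.
      by rewrite ler_sqr// nnegrE sqrtr_ge0.
    have [x0|x0] := leP x 0%R; first by rewrite expr0n/= mulr0.
    rewrite mulrC -ltr_pdivlMr// -(@sqr_sqrtr _ (t / s)%R)//.
    by rewrite ltr_sqr ?nnegrE ?sqrtr_ge0// ltW.
  + move=> /andP[xt ty].
    have t0 : (0 < t)%R by rewrite (le_lt_trans _ xt)// mulr_ge0 ?sqr_ge0// ltW.
    split=> //; have y0 : (0 < y)%R.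
      by rewrite ltNge; apply/negP => y0; move: ty; rewrite (max_r y0) expr0n/=
        mulr0 leNgt t0.
    have ts : (0 <= t / s)%R by rewrite divr_ge0// ltW.
    apply/andP; split.
      have [x0|x0] := ltP x 0%R; first by rewrite (lt_le_trans x0)// sqrtr_ge0.
      rewrite -ltr_sqr ?nnegrE ?sqrtr_ge0// sqr_sqrtr// ltr_pdivlMr// mulrC.
      by move: xt; rewrite max_l.
    rewrite -ler_sqr ?nnegrE ?sqrtr_ge0// ?(ltW y0)// sqr_sqrtr//.
    rewrite ler_pdivrMr// mulrC.
    by move: ty; rewrite max_l// ltW.
Qed.

Lemma continuous_inv1Dsqr : continuous (fun m : R => 2 / (1 + m ^+ 2))%R.
Proof.
move=> m; apply: cvgM; first exact: cvg_cst.
apply: cvgV; first by rewrite gt_eqF// ltr_pwDl// sqr_ge0.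
apply: cvgD; first exact: cvg_cst.
exact: (cvgM (@cvg_id _ _) (@cvg_id _ _)).
Qed.

Lemma measurable_angle :
  measurable_fun [set: R] (fun m : R => pi + 2 * atan m)%R.
Proof.
apply: measurable_funD => //; apply: measurable_funM => //.
by apply: continuous_measurable_fun => x; exact: continuous_atan.
Qed.

(** The Weierstrass substitution [m = tan ((p - pi) / 2)]; the shift by [pi] makes a single branch
    of the tangent cover the whole open interval. *)
Lemma ge0_integral_angle (f : R -> \bar R) :
  measurable_fun [set: R] f -> (forall x, 0 <= f x) ->
  \int[mu]_(p in `]0%R, (2 * pi)%R[) f p =
  \int[mu]_m (f (pi + 2 * atan m)%R * (2 / (1 + m ^+ 2))%:E).
Proof.
move=> mf f0.
have c2 := continuous_inv1Dsqr.
have halfP (p : R) : (0 < p < 2 * pi)%R ->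
    ((p - pi) / 2)%R \in `](- (pi / 2))%R, (pi / 2)%R[.
  by move=> /andP[p0 p2]; rewrite in_itv/=; apply/andP; split; lra.
have cos_gt0 (p : R) : (0 < p < 2 * pi)%R -> (0 < cos ((p - pi) / 2))%R.
  by move=> p2; apply: cos_gt0_pihalf; have := halfP p p2; rewrite in_itv.
apply: (@ge0_integral_comp (fun m => pi + 2 * atan m)%R
  (fun m => 2 / (1 + m ^+ 2))%R (fun p => tan ((p - pi) / 2))) => //.
- apply: open_continuous_measurable_fun; first exact: interval_open.
  move=> p /[!inE]/=; rewrite in_itv/= => p2.
  apply: (@continuous_comp _ _ _ (fun p : R => (p - pi) / 2)%R tan).
    apply: cvgM; last exact: cvg_cst.
    by apply: cvgB; [exact: cvg_id|exact: cvg_cst].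
  by apply: continuous_tan; rewrite gt_eqF// cos_gt0.
- exact: measurable_angle.
- exact: continuous_measurable_fun.
- by move=> x; rewrite divr_ge0// addr_ge0 ?sqr_ge0.
- move=> p /=; rewrite in_itv/= => p2.
  by rewrite tanK ?halfP//; field.
- move=> x y xy.
  apply: (@integral_itv_derive (fun m => pi + 2 * atan m)%R) => //.
  move=> z; have dF := is_deriveD (is_derive_cst (pi : R) z (1%R : R))
    (is_deriveZ 2%R (is_derive1_atan z)).
  by apply: (is_derive_eq dF); rewrite /GRing.scale/= add0r.
(* As [atan] is increasing, comparing tangents amounts to comparing half-angles, and only linear
   inequalities remain. *)
- have lt_atanE : {mono @atan R : x y / (x < y)%R} :=
    leW_mono (le_mono (@lt_atan R)).
  have le_atanE : {mono @atan R : x y / (x <= y)%R} := le_mono (@lt_atan R).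
  move=> x y xy; apply/seteqP; split=> p /=; rewrite !in_itv/=.
  + move=> [p2 /andP[]]; rewrite -lt_atanE -le_atanE tanK ?halfP// => h1 h2.
    by apply/andP; split; lra.
  + move=> /andP[h1 h2]; have := atan_gtNpi2 x; have := atan_ltpi2 y => h3 h4.
    have p2 : (0 < p < 2 * pi)%R by apply/andP; split; lra.
    split=> //; rewrite -lt_atanE -le_atanE tanK ?halfP//.
    by apply/andP; split; lra.
Qed.

End one_variable_substitutions.

(** * Polar coordinates through [quad] *)

Section quad_change_of_variables.
Local Open Scope ereal_scope.
Context {R : realType}.
Local Notation mu := (@lebesgue_measure R).

Lemma measurable_planar_quad : measurable_fun [set: R * R] (@planar_quad R).
Proof.
have m1 : measurable_fun setT (fun z : R * R => z.1) by exact: measurable_fst.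
have m2 : measurable_fun setT (fun z : R * R => z.2) by exact: measurable_snd.
apply: measurable_fun_pair; first apply: measurable_fun_pair.
- by apply: measurable_funB; exact: measurable_funX.
- by apply: measurable_funM => //; exact: measurable_funM.
- by apply: measurable_funD; exact: measurable_funX.
Qed.

Lemma ge0_integralN (f : R -> \bar R) :
  measurable_fun [set: R] f -> (forall x, 0 <= f x) ->
  \int[mu]_x f (- x)%R = \int[mu]_x f x.
Proof.
move=> mf f0.
have mN : measurable_fun setT (-%R : measurableTypeR R -> measurableTypeR R).
  exact: measurable_funN.
apply/esym/(ge0_integral_image_measure (mu := mu) (nu := mu) mN) => // A mA.
exact/esym/lebesgue_measureN.
Qed.

Lemma ge0_integral_even (f : R -> \bar R) :
  measurable_fun [set: R] f -> (forall x, 0 <= f x) ->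
  (forall x, f (- x)%R = f x) ->
  \int[mu]_x f x = 2%:E * \int[mu]_(x in `]0%R, +oo[) f x.
Proof.
move=> mf f0 fN.
have mfD (D : set R) : measurable_fun D f by exact: measurable_funTS.
rewrite (_ : [set: R] = `]-oo, 0%R]%classic `|` `]0%R, +oo[%classic);
  last first.
  apply/seteqP; split=> // x _; have [x0|x0] := leP x 0%R; [left|right];
  by rewrite /= in_itv/= ?andbT.
rewrite ge0_integral_setU//; last 2 first.
- exact: mfD.
- apply/disj_setPS => x [] /=; rewrite !in_itv/= andbT => x0.
  by rewrite ltNge x0.
set I := \int[mu]_(x in `]0%R, +oo[) f x.
transitivity (I + I); last first.
  by rewrite (_ : 2 = 1 + 1)%R// EFinD ge0_muleDl// mul1e.
congr (_ + _).
rewrite /I integral_itv_obnd_cbnd// ge0_integration_by_substitution0//.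
by apply: eq_integral => x _; rewrite fN.
Qed.

Variable H : R * R * R -> \bar R.
Hypotheses (mH : measurable_fun [set: R * R * R] H) (H0 : forall p, 0 <= H p).
Hypothesis HN : forall p : R * R * R, (p.2 < 0)%R -> H p = 0.

(** By [HN], this is the integral along the ray of angle [p]: negative [t] contribute nothing. *)
Let L (p : R) := \int[mu]_t H (cone_param (t, p)).

Lemma measurable_cone_param_swap : measurable_fun [set: R * R]
  (fun z : R * R => H (cone_param (z.2, z.1))).
Proof.
have msw : measurable_fun [set: R * R] (fun z : R * R => (z.2, z.1)).
  exact: measurable_swap.
exact: (measurableT_comp mH (measurableT_comp (@measurable_cone_param R) msw)).
Qed.

Lemma measurable_integral_cone_param : measurable_fun [set: R] L.
Proof.
exact: (@measurable_fun_fubini_tonelli_F _ _ (measurableTypeR R)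
  (measurableTypeR R) R mu _ measurable_cone_param_swap (fun z => H0 _)).
Qed.

Let L0 p : 0 <= L p.
Proof. exact: integral_ge0. Qed.

(** The rational parametrization of the circle by the tangent of the half-angle; the shift by [pi]
    changes both signs. *)
Let cone_param_atan (t m : R) : cone_param (t, (pi + 2 * atan m)%R) =
  (t * ((m ^+ 2 - 1) / (1 + m ^+ 2)), t * (- (2 * m) / (1 + m ^+ 2)), t)%R.
Proof.
have m2 : (0 < 1 + m ^+ 2)%R by rewrite ltr_pwDl// sqr_ge0.
have c2 : (cos (atan m) ^+ 2 = (1 + m ^+ 2)^-1 :> R)%R.
  by rewrite cos_atan exprVn sqr_sqrtr// ltW.
have sE : (sin (atan m) = m * cos (atan m) :> R)%R.
  have cN0 : cos (atan m) != 0%R.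
    by rewrite cos_atan invr_eq0 sqrtr_eq0 -ltNge.
  by rewrite -{2}(atanK m) /tan divfK.
rewrite /cone_param/= addrC cosDpi sinDpi mulr_natl cos_mulr2n sin_mulr2n sE.
congr (_ * _, _ * _, _)%R.
  by rewrite c2; field; rewrite gt_eqF.
rewrite (_ : cos (atan m) * (m * cos (atan m)) = m * cos (atan m) ^+ 2)%R.
  by rewrite c2; field; rewrite gt_eqF.
by ring.
Qed.

(** Each half-plane contributes one quarter of the integral in [t] and [p], whence the factor 1/2.
    Domains and weights are meant to be part of [H], so that the left-hand integral runs over the
    whole plane. *)
Lemma integral_planar_quad :
  \int[@lebesgue2 R]_z H (planar_quad z) =
  (1 / 2)%:E *
    \int[mu]_(p in `[0%R, (2 * pi)%R[) \int[mu]_t H (cone_param (t, p)).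
Proof.
pose f (z : R * R) := H (planar_quad z).
have mf : measurable_fun setT f.
  exact: (measurableT_comp mH measurable_planar_quad).
have f0 z : 0 <= f z by exact: H0.
pose K v := \int[mu]_u f (u, v).
have mK : measurable_fun [set: R] K.
  exact: (@measurable_fun_fubini_tonelli_G _ _ (measurableTypeR R)
    (measurableTypeR R) R mu f).
have K0 v : 0 <= K v by exact: integral_ge0.
have mf1 v : measurable_fun [set: R] (fun u => f (u, v)).
  exact: (measurableT_comp mf (measurable_fun_pair (@measurable_id _ R setT)
    (@measurable_cst _ _ R R setT v))).
(* [planar_quad] is even, so a sign moves from one coordinate to the other; this makes [K] even. *)
have fN u v : f ((- u)%R, v) = f (u, (- v)%R).
  by rewrite /f /planar_quad/= !sqrrN mulrN mulrN mulNr.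
have KN v : K (- v)%R = K v.
  rewrite /K -[RHS]ge0_integralN//.
  by apply: eq_integral => u _; rewrite fN.
(* The integrand after [u = - v * m], with Jacobian [v] truncated at 0 so that Tonelli's theorem
   applies on the whole plane. *)
pose k (v m : R) := f ((- (v * m))%R, v) * (Num.max v 0%R)%:E.
have mk : measurable_fun setT (fun z : R * R => k z.1 z.2).
  have m1 : measurable_fun setT (fun z : R * R => z.1) by exact: measurable_fst.
  have m2 : measurable_fun setT (fun z : R * R => z.2) by exact: measurable_snd.
  apply: emeasurable_funM.
    apply: (measurableT_comp mf); apply: measurable_fun_pair => //.
    by apply: measurableT_comp => //; exact: measurable_funM.
  by apply/measurable_EFinP; exact: measurable_maxr.
have k0 v m : 0 <= k v m by rewrite mule_ge0// lee_fin le_max lexx orbT.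
have KE : \int[mu]_(v in `]0%R, +oo[) K v = \int[mu]_v \int[mu]_m k v m.
  rewrite integral_mkcond; apply: eq_integral => v _; rewrite patchE.
  case: ifPn; rewrite (inE, notin_setE)/= in_itv/= andbT => v0.
    rewrite /K -[LHS]ge0_integralN// (ge0_integral_scale v0)//; last first.
      by apply: (measurableT_comp (mf1 v)); exact: measurable_funN.
    by apply: eq_integral => m _; rewrite /k max_l ?ltW.
  rewrite integral0_eq// => m _; rewrite /k max_r ?mule0//.
  by rewrite leNgt; apply/negP.
(* The constant comes from the Jacobians of [t] and of the angle: [2 * (1 + m ^+ 2) * v] times
   [2 / (1 + m ^+ 2)] is [4 * v]. *)
have kE m : \int[mu]_v k v m =
    4^-1%:E * (L (pi + 2 * atan m) * (2 / (1 + m ^+ 2))%:E).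
  have s0 : (0 < 1 + m ^+ 2)%R by rewrite ltr_pwDl// sqr_ge0.
  have mh : measurable_fun [set: R]
      (fun t => H (cone_param (t, pi + 2 * atan m)%R)).
    exact: (measurableT_comp measurable_cone_param_swap
      (measurable_fun_pair (@measurable_cst _ _ R R setT (pi + 2 * atan m)%R)
        (@measurable_id _ R setT))).
  have -> : L (pi + 2 * atan m) =
      \int[mu]_(t in `]0%R, +oo[) H (cone_param (t, pi + 2 * atan m)%R).
    rewrite integral_itv_obnd_cbnd; last exact: measurable_funTS.
    rewrite [RHS]integral_mkcond; apply: eq_integral => t _; rewrite patchE.
    case: ifPn => //; rewrite notin_setE/= in_itv/= andbT => /negP.
    by rewrite -ltNge => t0; rewrite HN.
  rewrite (ge0_integral_square s0)//.
  have mmax : measurable_fun [set: R] (fun v : R => Num.max v 0)%R.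
    exact: measurable_maxr.
  have mg : measurable_fun [set: R] (fun v =>
      H (cone_param ((1 + m ^+ 2) * Num.max v 0 ^+ 2, pi + 2 * atan m)%R) *
      (2 * (1 + m ^+ 2) * Num.max v 0)%:E).
    apply: emeasurable_funM.
      apply: (measurableT_comp mh); apply: measurable_funM => //.
      exact: measurable_funX.
    by apply/measurable_EFinP; exact: measurable_funM.
  have max0 v : (0 <= Num.max v 0 :> R)%R by rewrite le_max lexx orbT.
  rewrite -ge0_integralZr//; last 2 first.
  - by move=> v _; rewrite mule_ge0// lee_fin !mulr_ge0// ltW.
  - by rewrite lee_fin divr_ge0// ltW.
  rewrite -ge0_integralZl//; last 2 first.
  - exact: emeasurable_funM.
  - move=> v _; rewrite !mule_ge0// lee_fin; first by rewrite !mulr_ge0// ltW.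
    by rewrite divr_ge0// ltW.
  apply: eq_integral => v _; rewrite cone_param_atan /k.
  have [v0|v0] := ltP 0%R v; last by rewrite !(mulr0,mule0,mul0e).
  rewrite muleCA -!muleA -!EFinM; congr (_ * _%:E).
    rewrite /f /planar_quad/=; congr (H (_, _, _));
      [by field; rewrite gt_eqF|by field; rewrite gt_eqF|by ring].
  by field; rewrite gt_eqF.
rewrite /lebesgue2 (@fubini_tonelli2 _ _ (measurableTypeR R)
  (measurableTypeR R) R mu mu f)//.
rewrite -/(K _) ge0_integral_even// KE.
(* Exchanging the order fixes the slope [m], so that the inner integral is radial and [kE] evaluates
   it. *)
rewrite (@fubini_tonelli _ _ (measurableTypeR R) (measurableTypeR R) R mu mu
  (fun z => k z.1 z.2))//=.
under eq_integral do rewrite kE.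
have mang : measurable_fun [set: R]
    (fun m => L (pi + 2 * atan m) * (2 / (1 + m ^+ 2))%:E).
  apply: emeasurable_funM.
    exact: (measurableT_comp measurable_integral_cone_param measurable_angle).
  apply/measurable_EFinP.
  by apply: continuous_measurable_fun; exact: continuous_inv1Dsqr.
rewrite ge0_integralZl//; last first.
  by move=> m _; rewrite mule_ge0// lee_fin divr_ge0// addr_ge0 ?sqr_ge0.
rewrite -(ge0_integral_angle measurable_integral_cone_param L0) muleA -EFinM.
congr (_%:E * _); first by field.
have mLD (D : set R) : measurable_fun D L.
  exact: (measurable_funTS measurable_integral_cone_param).
(* The two ranges of angles differ only by the null set of the endpoint 0. *)
rewrite integral_itv_bndoo; last exact: mLD.
by rewrite [RHS]integral_itv_bndoo//; exact: mLD.
Qed.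

End quad_change_of_variables.

(** * Square-integrable functions *)

Section L2_classes.
Context d (T : measurableType d) (R : realType).
Variable mu : {measure set T -> \bar R}.

Lemma ae_eq_L2norm (f g : T -> R) :
  measurable_fun [set: T] f -> measurable_fun [set: T] g ->
  f = g %[ae mu] -> ('N[mu]_2%:E[EFin \o f] = 'N[mu]_2%:E[EFin \o g])%E.
Proof.
move=> mf mg fg; rewrite unlock; congr (_ `^ _)%E.
have m2 (h : T -> R) : measurable_fun [set: T] h ->
    measurable_fun [set: T] (fun x => `|(EFin \o h) x| `^ 2)%E.
  move=> mh; rewrite (_ : (fun x => _) = EFin \o (fun x => `|h x| `^ 2)%R)//.
  apply/measurable_EFinP.
  by apply: (measurableT_comp (measurable_powR _)); exact: measurableT_comp.
apply: ge0_ae_eq_integral => //.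
- exact: m2.
- exact: m2.
- by move=> x _; exact: poweR_ge0.
- by move=> x _; exact: poweR_ge0.
- by apply: filterS fg => x /(_ I) /= -> .
Qed.

Lemma measurable_L2 (F : LspaceType2 mu) : measurable_fun [set: T] (F : T -> R).
Proof.
exact: (measurable_funP (repr (F : {mfun_ mu, T >-> measurableTypeR R}))).
Qed.

(** An element is a class of the quotient by almost everywhere equality together with a proof that
    its norm is finite, and such proofs are equal. *)
Lemma L2_inj (F G : LspaceType2 mu) : (F : T -> R) = G %[ae mu] -> F = G.
Proof.
move=> FG.
have : (F : {mfun_ mu, T >-> measurableTypeR R}) = G.
  by rewrite -[LHS]reprK -[RHS]reprK; apply/eqmodP/asboolP.
case: F G {FG} => [f [[fP]]] [g [[gP]]] /= fg; subst g.
by rewrite (Prop_irrelevance fP gP).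
Qed.

(** Pullback and composition with the section act on functions; this brings their results back to
    classes. *)
Lemma L2_surj (h : T -> R) :
  measurable_fun [set: T] h -> finite_norm mu 2%:E h ->
  exists F : LspaceType2 mu, (F : T -> R) = h %[ae mu].
Proof.
move=> mh h2.
have mhR : measurable_fun [set: T] (h : T -> measurableTypeR R) := mh.
pose hm : {mfun T >-> measurableTypeR R} :=
  HB.pack (h : T -> measurableTypeR R) (isMeasurableFun.Build _ _ _ _ _ mhR).
pose F : {mfun_ mu, T >-> measurableTypeR R} := (\pi hm)%qT.
have Fh : (F : T -> R) = h %[ae mu].
  have /eqmodP/asboolP :
      (repr F = hm %[mod {mfun_ mu, T >-> measurableTypeR R}])%qT.
    by rewrite reprK.
  by [].
have F2 : finite_norm mu 2%:E F.
  rewrite /finite_norm (ae_eq_L2norm _ mh Fh)//.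
  exact: (measurable_funP (repr F)).
pose F' : LspaceType mu (lee1n 2) :=
  HB.pack F (isFinLebesgue.Build _ _ _ mu _ (lee1n 2) F F2).
by exists F'.
Qed.

End L2_classes.

(** * Measurability of the maps, and the image of the disc measure under [quad] *)

Section measures_of_quad.
Context {R : realType}.
Local Open Scope ereal_scope.
Local Notation mu := (@lebesgue_measure R).

Lemma measurable_disc_val : measurable_fun [set: disc R] (@disc_val R).
Proof. by move=> _ B mB; rewrite setTI; exists B; rewrite ?setTI. Qed.

Lemma measurable_cone_val : measurable_fun [set: cone R] (@cone_val R).
Proof. by move=> _ B mB; rewrite setTI; exists B; rewrite ?setTI. Qed.

(** The cone carries the trace sigma-algebra, so each of its measurable sets is the preimage of one
    in space. *)
Lemma measurable_fun_cone d (T : measurableType d) (f : T -> cone R) :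
  measurable_fun [set: T] (@cone_val R \o f) -> measurable_fun [set: T] f.
Proof.
move=> mf _ _ [B mB <-]; rewrite [X in f @^-1` X]setTI.
exact: (mf measurableT B mB).
Qed.

Lemma measurable_fun_disc d (T : measurableType d) (f : T -> disc R) :
  measurable_fun [set: T] (@disc_val R \o f) -> measurable_fun [set: T] f.
Proof.
move=> mf _ _ [B mB <-]; rewrite [X in f @^-1` X]setTI.
exact: (mf measurableT B mB).
Qed.

Lemma measurable_quad : measurable_fun [set: disc R] (@quad R).
Proof.
apply: measurable_fun_cone.
exact: (measurableT_comp (@measurable_planar_quad R) measurable_disc_val).
Qed.

Lemma measurable_half_angle : measurable_fun [set: R * R * R] (@half_angle R).
Proof.
have m11 : measurable_fun setT (fun p : R * R * R => p.1.1).
  exact: (measurableT_comp measurable_fst measurable_fst).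
have m12 : measurable_fun setT (fun p : R * R * R => p.1.2).
  exact: (measurableT_comp measurable_snd measurable_fst).
have m2 : measurable_fun setT (fun p : R * R * R => p.2).
  exact: measurable_snd.
have msqrt := continuous_measurable_fun (@sqrt_continuous R).
apply: measurable_fun_pair.
  apply: (measurableT_comp msqrt); apply: measurable_funM => //.
  exact: measurable_funD.
apply: measurable_funM.
  by apply: measurable_fun_ifT => //; exact: measurable_fun_ltr.
apply: (measurableT_comp msqrt); apply: measurable_funM => //.
exact: measurable_funB.
Qed.

Lemma measurable_quad_section : measurable_fun [set: cone R] (@quad_section R).
Proof.
apply: measurable_fun_disc.
exact: (measurableT_comp measurable_half_angle measurable_cone_val).
Qed.

Lemma measurable_planar_opp :
  measurable_fun [set: R * R] (fun z : R * R => (- z.1, - z.2)%R).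
Proof.
by apply: measurable_fun_pair; apply: measurableT_comp;
  [exact: measurable_funN|exact: measurable_fst|
   exact: measurable_funN|exact: measurable_snd].
Qed.

Lemma measurable_disc_opp : measurable_fun [set: disc R] (@disc_opp R).
Proof.
apply: measurable_fun_disc.
exact: (measurableT_comp measurable_planar_opp measurable_disc_val).
Qed.

(** By Tonelli's theorem, the central symmetry splits into two reflections of the line. *)
Lemma ge0_integral_lebesgue2N (G : R * R -> \bar R) :
  measurable_fun [set: R * R] G -> (forall z, 0 <= G z) ->
  \int[@lebesgue2 R]_z G (- z.1, - z.2)%R = \int[@lebesgue2 R]_z G z.
Proof.
move=> mG G0.
have mGN := measurableT_comp mG measurable_planar_opp.
have E1 := @fubini_tonelli2 _ _ (measurableTypeR R) (measurableTypeR R) R mu mu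
  _ mGN (fun z => G0 _).
have E2 := @fubini_tonelli2 _ _ (measurableTypeR R) (measurableTypeR R) R mu mu
  G mG G0.
rewrite /lebesgue2; apply: (etrans E1); apply: (etrans _ (esym E2)).
have mK := @measurable_fun_fubini_tonelli_G _ _ (measurableTypeR R)
  (measurableTypeR R) R mu G mG G0.
rewrite -[RHS]ge0_integralN; [|exact: mK|by move=> v; exact: integral_ge0].
apply: eq_integral => v _; rewrite /fubini_G/= -[RHS]ge0_integralN//.
exact: (measurableT_comp mG (measurable_fun_pair (@measurable_id _ R setT)
    (@measurable_cst _ _ R R setT (- v)%R))).
Qed.

Variables (gamma : R) (gamma_gtN1 : (-1 < gamma)%R).

(** The density depends only on the squares of the coordinates. This lets null sets be carried along
    [disc_opp]. *)
Lemma disc_measure_opp (A : set (disc R)) : measurable A ->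
  disc_measure gamma_gtN1 (@disc_opp R @^-1` A) = disc_measure gamma_gtN1 A.
Proof.
move=> mA; rewrite /disc_measure integral_mkcond [RHS]integral_mkcond.
rewrite -[RHS]ge0_integral_lebesgue2N; first last.
- by move=> z; apply: erestrict_ge0 => w _; rewrite lee_fin disc_density_ge0.
- apply/(measurable_restrictT _ (measurable_disc_val_image mA)).
  by apply/measurable_funTS/measurable_EFinP; exact: measurable_disc_density.
apply: eq_integral => z _; rewrite !patchE /disc_density/= !sqrrN.
congr (if _ then _ else _); apply/idP/idP; rewrite !inE => -[w Aw wE].
  by exists (disc_opp w) => //; rewrite /= -wE.
exists (disc_opp w); first by rewrite /preimage/= disc_oppK.
rewrite [LHS](_ : _ = (- (disc_val w).1, - (disc_val w).2)%R)// wE/= !opprK.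
by case: (z).
Qed.

Lemma cone_measure_quad (A : set (cone R)) : measurable A ->
  cone_measure gamma_gtN1 A = disc_measure gamma_gtN1 (@quad R @^-1` A).
Proof.
move=> mA; pose A' := @cone_val R @` A.
have mA' : measurable A' by exact: measurable_cone_val_image.
have A'cone p : A' p -> cone_set p by move=> [q _ <-]; exact: set_valP q.
(* The disc density written in [t = u ^+ 2 + v ^+ 2] and cut off by the set. The factor 1/2 of
   [integral_planar_quad] then turns the constant [(gamma + 1) / pi] into that of the cone. *)
pose H (p : R * R * R) : \bar R :=
  ((gamma + 1) / pi * (1 - p.2) `^ gamma * \1_A' p)%:E.
have mH : measurable_fun [set: R * R * R] H.
  apply/measurable_EFinP; apply: measurable_funM; last exact: measurable_indic.
  apply: measurable_funM => //; apply: (measurableT_comp (measurable_powR _)).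
  by apply: measurable_funB => //; exact: measurable_snd.
have H0 p : 0 <= H p.
  have g1 : (0 <= gamma + 1)%R by rewrite -lerBlDr sub0r ltW.
  rewrite lee_fin; apply: mulr_ge0 => //; apply: mulr_ge0; last exact: powR_ge0.
  by apply: divr_ge0 => //; exact: pi_ge0.
have HN (p : R * R * R) : (p.2 < 0)%R -> H p = 0.
  move=> p0; rewrite /H indicE memNset ?mulr0// => /A'cone[_ /andP[]].
  by rewrite leNgt p0.
transitivity (\int[@lebesgue2 R]_z H (planar_quad z)).
  rewrite (integral_planar_quad mH H0 HN).
  pose D := @cone_param_dom R `&` @cone_param R @^-1` A'.
  have mD : measurable D.
    apply: measurableI; first exact: measurable_cone_param_dom.
    by rewrite -[X in measurable X]setTI; exact: measurable_cone_param.
  pose c := (fun z => (cone_density gamma z)%:E) \_ D.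
  have mc : measurable_fun [set: R * R] c.
    apply/(measurable_restrictT _ mD)/measurable_funTS/measurable_EFinP.
    exact: measurable_cone_density.
  have c0 z : 0 <= c z.
    by apply: erestrict_ge0 => w _; rewrite lee_fin cone_density_ge0.
  have E := @fubini_tonelli2 _ _ (measurableTypeR R) (measurableTypeR R) R mu mu
    c mc c0.
  rewrite /cone_measure integral_mkcond; apply: (etrans E).
  have mI := measurable_integral_cone_param mH H0.
  rewrite -ge0_integralZl//; last 2 first.
  - exact: measurable_funTS.
  - by move=> p _; exact: integral_ge0.
  rewrite [RHS]integral_mkcond; apply: eq_integral => p _.
  rewrite patchE; case: ifPn; rewrite (inE, notin_setE)/= in_itv/= => p2.
    have mHp : measurable_fun [set: R] (fun t => H (cone_param (t, p))).
      exact: (measurableT_comp (measurable_cone_param_swap mH)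
        (measurable_fun_pair (@measurable_cst _ _ R R setT p)
          (@measurable_id _ R setT))).
    rewrite -ge0_integralZl//.
    apply: eq_integral => t _; rewrite /c patchE /H indicE; case: ifPn.
      rewrite inE => -[_ At]; rewrite mem_set// mulr1 -EFinM; congr EFin.
      (* [pi] is generalized because [field] would unfold it. *)
      rewrite /cone_density/=; move: (@pi R) (pi_gt0 R) => q q0.
      by field; rewrite gt_eqF.
    (* Points of the cone have [0 <= t <= 1], so for this [p] the indicator vanishes outside [D] as
       well. *)
    rewrite notin_setE => nD; rewrite memNset ?mulr0 ?mule0// => At.
    by apply: nD; split=> //; split=> //; have [_] := A'cone _ At.
  apply: integral0_eq => t _; rewrite /c patchE ifN//.
  by rewrite notin_setE => -[[_]].
rewrite /disc_measure [RHS]integral_mkcond; apply: eq_integral => z _.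
rewrite patchE /H indicE; case: ifPn; rewrite (inE, notin_setE).
  move=> [w Aw <-]; rewrite mem_set ?mulr1; last by exists (quad w).
  by rewrite /disc_density/= opprD addrA.
move=> nA; rewrite memNset ?mulr0// => -[p Ap pz]; apply: nA.
(* The squared norm of [z] is the third coordinate of a point of the cone, hence at most 1. *)
have dz : disc_set z.
  have [_ /andP[_]] := A'cone _ (ex_intro2 _ _ p Ap pz); exact.
exists (SigSub (mem_set dz)) => //; rewrite /preimage/=.
rewrite (_ : quad _ = p)//; apply: cone_val_inj.
by rewrite pz cone_val_quad.
Qed.

End measures_of_quad.

(** * Transfer of null sets and norms, and the isomorphism of the L2 spaces *)

Section pullback_L2.
Context {R : realType}.
Variables (gamma : R) (gamma_gtN1 : -1 < gamma).
Local Notation nu := (cone_measure gamma_gtN1).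
Local Notation mu := (disc_measure gamma_gtN1).

Lemma ge0_integral_cone_measure (h : cone R -> \bar R) :
  measurable_fun [set: cone R] h -> (forall p, 0 <= h p)%E ->
  (\int[nu]_p h p = \int[mu]_z h (quad z))%E.
Proof.
move=> mh h0.
apply: (ge0_integral_image_measure (@measurable_quad R)) => // A mA.
exact: cone_measure_quad.
Qed.

Lemma measurable_pullback (f : cone R -> R) :
  measurable_fun [set: cone R] f -> measurable_fun [set: disc R] (pullback f).
Proof. by move=> mf; exact: (measurableT_comp mf (@measurable_quad R)). Qed.

Lemma L2norm_pullback (f : cone R -> R) : measurable_fun [set: cone R] f ->
  ('N[mu]_2%:E[EFin \o pullback f] = 'N[nu]_2%:E[EFin \o f])%E.
Proof.
move=> mf; rewrite unlock; congr (_ `^ _)%E.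
rewrite ge0_integral_cone_measure//.
  rewrite (_ : (fun p => _) = EFin \o (fun p => `|f p| `^ 2)%R)//.
  apply/measurable_EFinP.
  by apply: (measurableT_comp (measurable_powR _)); exact: measurableT_comp.
by move=> p; exact: poweR_ge0.
Qed.

Lemma ae_quad (P : cone R -> Prop) :
  {ae nu, forall p, P p} -> {ae mu, forall z, P (quad z)}.
Proof.
move=> [N [mN N0 PN]]; exists (@quad R @^-1` N); split.
- by rewrite -[X in measurable X]setTI; exact: measurable_quad.
- by rewrite -cone_measure_quad.
- by move=> z nPz; exact: PN.
Qed.

(** The exceptional set is the complement of [P] itself, and [cone_measure_quad] computes its
    measure as that of its preimage. *)
Lemma ae_cone (P : cone R -> Prop) : measurable [set p | P p] ->
  {ae mu, forall z, P (quad z)} -> {ae nu, forall p, P p}.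
Proof.
move=> mP Pquad.
have mNP : measurable (~` [set p | P p]) by exact: measurableC.
exists (~` [set p | P p]); split => //.
rewrite cone_measure_quad//; apply: measure_negligible => //.
by rewrite -[X in measurable X]setTI; exact: measurable_quad.
Qed.

Lemma ae_disc_opp (P : disc R -> Prop) :
  {ae mu, forall z, P z} -> {ae mu, forall z, P (disc_opp z)}.
Proof.
move=> [N [mN N0 PN]]; exists (@disc_opp R @^-1` N); split.
- by rewrite -[X in measurable X]setTI; exact: measurable_disc_opp.
- by rewrite disc_measure_opp.
- by move=> z nPz; exact: PN.
Qed.

Lemma ae_eq_pullback (f g : cone R -> R) :
  f = g %[ae nu] -> pullback f = pullback g %[ae mu].
Proof. exact: ae_quad. Qed.

Lemma ae_eq_of_pullback (f g : cone R -> R) :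
  measurable_fun [set: cone R] f -> measurable_fun [set: cone R] g ->
  pullback f = pullback g %[ae mu] -> f = g %[ae nu].
Proof.
move=> mf mg; apply: ae_cone.
rewrite (_ : [set p | _] = (f \- g) @^-1` [set 0]).
  by rewrite -[X in measurable X]setTI; exact: measurable_funB.
apply/seteqP; split=> p /=; first by move=> /(_ I) ->; rewrite subrr.
by move=> /eqP; rewrite subr_eq0 => /eqP.
Qed.

Lemma pullback_L2_isomorphism :
  exists Phi : LspaceType2 nu -> LspaceType2 mu,
     [/\ L2_induced_by_pullback Phi,
         L2_linear Phi,
         L2_isometry Phi
       & set_bij [set: LspaceType2 nu] (L2_even gamma_gtN1) Phi].
Proof.
have mrep (f : LspaceType2 nu) := measurable_pullback (measurable_L2 f).
(* Each class is sent to the class of the pullback of its chosen representative; equality of norms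
   makes that pullback square-integrable. *)
have /choice[Phi PhiE] (f : LspaceType2 nu) :
    exists F : LspaceType2 mu, (F : disc R -> R) = pullback f %[ae mu].
  apply: L2_surj => //; rewrite /finite_norm L2norm_pullback.
    exact: Lebesgue_finite.
  exact: measurable_L2.
exists Phi; split.
- move=> f g mg fg; apply: ae_eq_trans (PhiE f) _; exact: ae_eq_pullback.
- move=> a f g h /ae_eq_pullback hfg.
  apply: filterS2 (filterI (PhiE f) (PhiE g)) (filterI (PhiE h) hfg).
  by move=> z [fz gz] [hz hfgz] _; rewrite fz// gz// hz//; exact: hfgz.
- move=> f; rewrite /L2norm -L2norm_pullback; last exact: measurable_L2.
  by apply: ae_eq_L2norm => //; exact: measurable_L2.
- split.
  (* The image class agrees with an even function almost everywhere, both at [z] and at its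
     opposite. *)
  + move=> f _; have fE := PhiE f; rewrite /L2_even/=.
    apply: filterS2 fE (ae_disc_opp fE) => z h1 h2.
    by rewrite h1// h2// /pullback/= quad_opp.
  + move=> f g _ _ fg; apply: L2_inj.
    apply: ae_eq_of_pullback; [exact: measurable_L2|exact: measurable_L2|].
    by apply: ae_eq_trans _ (PhiE g); rewrite -fg; apply/ae_eq_sym/PhiE.
  (* The preimage is the class of [h]: since [F] is even only almost everywhere, [pullback h] equals
     [F] only almost everywhere. *)
  + move=> F evenF; pose h := (F : disc R -> R) \o @quad_section R.
    have mh : measurable_fun [set: cone R] h.
      exact: (measurableT_comp (measurable_L2 F) (@measurable_quad_section R)).
    have hF : pullback h = (F : disc R -> R) %[ae mu].
      apply: filterS evenF => z Fz _; rewrite /pullback/h/=.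
      by case: (quad_sectionP z) => ->.
    have [f fh] : exists f : LspaceType2 nu, (f : cone R -> R) = h %[ae nu].
      (* The norm of [h] is that of its pullback, hence that of [F], which is finite. *)
      apply: L2_surj => //; rewrite /finite_norm -L2norm_pullback//.
      rewrite (ae_eq_L2norm _ _ hF); first exact: Lebesgue_finite.
        exact: measurable_pullback.
      exact: measurable_L2.
    exists f => //; apply: L2_inj; apply: ae_eq_trans (PhiE f) _.
    by apply: ae_eq_trans _ hF; exact: ae_eq_pullback.
Qed.

End pullback_L2.

Theorem corollary3p2 (R : realType) (gamma : R) (gamma_gtN1 : -1 < gamma) :
  (exists Phi : LspaceType2 (cone_measure gamma_gtN1) ->
                LspaceType2 (disc_measure gamma_gtN1),
     [/\ L2_induced_by_pullback Phi,
         L2_linear Phi,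
         L2_isometry Phi
       & set_bij [set: LspaceType2 (cone_measure gamma_gtN1)]
                 (L2_even gamma_gtN1) Phi]) /\
  [/\ linear (@pullback R),
      (forall f : cone R -> R, C_cone R f ->
         uniform_norm (pullback f) = uniform_norm f)
    & set_bij (C_cone R) (C_even R) (@pullback R)].
Proof.
split; first exact: pullback_L2_isomorphism.
split.
- by move=> a f g.
- by move=> f _; exact: uniform_norm_pullback.
- exact: set_bij_pullback_continuous.
Qed.
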